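(* There exists an absolute constant $c\in(0,1)$ such that the following holds. For every integer $n\ge 1$, every real $\delta$ with $\frac1n<\delta<1$, and every $S\subseteq\{-1,1\}^n$ with $|S|\le 2^{\delta n}$, there exist orthonormal vectors $x_1,\ldots,x_n$ in $\mathbb{R}^n$ such that $$\left\|\sum_{i=1}^n\epsilon_i x_i\right\|_\infty\ge c\sqrt{\log(e/\delta)}$$ for all $(\epsilon_1,\ldots,\epsilon_n)\in S$.
   Context: Here $\|x\|_\infty=\max_{1\le j\le n}|x_j|$ for $x\in\mathbb{R}^n$, $|S|$ is the cardinality of $S$, $\log$ is the natural logarithm, and orthonormality is with respect to the standard Euclidean inner product. ''Absolute constant'' means that $c$ does not depend on $n$, $\delta$ or $S$. *)

(* Defs.v *)
From HB Require Import structures.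
From mathcomp Require Import all_boot all_order all_algebra.
From mathcomp Require Import finmap.
From mathcomp Require Import all_classical all_reals all_analysis.
Import Order.TTheory GRing.Theory Num.Theory.
Import numFieldNormedType.Exports.

Set Implicit Arguments.
Unset Strict Implicit.
Unset Printing Implicit Defensive.

Local Open Scope ring_scope.

(* Vectors of R^n are row vectors; on these the library's [mx_norm] is the
   maximum of the absolute values of the entries (cf. [mx_normrE]). *)

Definition sign_vector (R : realType) (n : nat) (e : 'rV[R]_n) : Prop :=
  forall i : 'I_n, e 0 i = -1 \/ e 0 i = 1.

Definition dotprod (R : realType) (n : nat) (u v : 'rV[R]_n) : R :=
  \sum_(j < n) u 0 j * v 0 j.

Definition orthonormal_family (R : realType) (n k : nat) (x : 'I_k -> 'rV[R]_n) : Prop :=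
  forall i j : 'I_k, dotprod (x i) (x j) = (i == j)%:R.

(* Main.v *)
Require Import Defs.
From HB Require Import structures.
From mathcomp Require Import all_boot all_order all_algebra.
From mathcomp Require Import finmap.
From mathcomp Require Import all_classical all_reals all_analysis.
From mathcomp Require Import ring zify.
Import Order.TTheory GRing.Theory Num.Theory.
Import numFieldNormedType.Exports.
Set Implicit Arguments.
Unset Strict Implicit.
Unset Printing Implicit Defensive.

Local Open Scope ring_scope.

(** Take [k] maximal with [4 ^ k * delta <= 1], so that [ln (e / delta) = O(k)], and cut
    the coordinates into [n %/ k] blocks of length [k] (for [k < 2] the standard basis will
    do).  Choosing, block after block, the sign pattern most popular among the vectors
    not yet matched removes a fraction at least [2 ^ - k] of them each time; as
    [(1 - 2 ^ - k) ^ (n %/ k) * 2 ^ (delta n) < 1], this yields one sign vector [g] that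
    every [e] in [S] agrees with on a whole block.  If the orthogonal matrix [V] has among
    its columns the normalized indicators of the blocks, then for [x_i = g_i (row i V)]
    one of the coordinates of [\sum_i e_i x_i] is [k / sqrt k = sqrt k]. *)

(** * Greedy choice of patterns *)

Lemma pigeonhole_popular (T : Type) (P : finType) (p0 : P) (f : T -> P) (s : seq T) :
  exists q, (size s <= #|P| * count (fun x => f x == q) s)%N.
Proof.
have P0 : (0 < #|P|)%N by apply/card_gt0P; exists p0.
have sumE : (\sum_(q : P) count (fun x => f x == q) s = size s)%N.
  elim: s => [|x s IH] /=; first by rewrite big1.
  by rewrite big_split /= IH (bigD1 (f x)) //= eqxx big1 // => q /negPf; rewrite eq_sym => ->.
apply/existsP; apply: contraT; rewrite negb_exists => /forallP small.
have : (\sum_(q : P) (#|P| * count (fun x => f x == q) s).+1 <= \sum_(q : P) size s)%N.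
  by apply: leq_sum => q _; rewrite ltnNge.
under eq_bigr do rewrite -addn1.
by rewrite big_split /= -big_distrr /= sumE !sum_nat_const muln1 -{2}[(_ * size s)%N]addn0 leq_add2l leqNgt P0.
Qed.

(** Each step adds the value most popular among the elements not yet hit, so the misses shrink by
    the factor [1 - 1 / #|P|]. Clearing denominators keeps the bound in [nat]. *)
Lemma greedy_hitting (T : Type) (P : finType) (p0 : P) (f : nat -> T -> P) (s : seq T) (m : nat) :
  exists p : nat -> P,
    (count (fun x => all (fun b => f b x != p b) (iota 0 m)) s * #|P| ^ m
      <= #|P|.-1 ^ m * size s)%N.
Proof.
elim: m => [|m [p IH]].
  by exists (fun=> p0); rewrite !expn0 muln1 mul1n count_size.
pose s' := [seq x <- s | all (fun b => f b x != p b) (iota 0 m)].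
have [q hq] := pigeonhole_popular p0 (f m) s'.
exists (fun b => if b == m then q else p b).
have -> : count (fun x => all (fun b => f b x != if b == m then q else p b) (iota 0 m.+1)) s
          = count (predC (fun x => f m x == q)) s'.
  rewrite /s' count_filter; apply: eq_count => x; rewrite [RHS]/=.
  rewrite -[m.+1]addn1 iotaD all_cat /= add0n eqxx andbT andbC; congr (_ && _).
  apply: eq_in_all => b; rewrite mem_iota add0n => /andP[_ bm].
  by rewrite (ltn_eqF bm).
have P0 : (0 < #|P|)%N by apply/card_gt0P; exists p0.
have hs := count_predC (fun x => f m x == q) s'.
have hs' : (count (predC (fun x => f m x == q)) s' * #|P| <= #|P|.-1 * size s')%N.
  rewrite -(prednK P0) in hq *.
  by move: hq hs; rewrite /=; nia.
rewrite -size_filter -/s' in IH.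
rewrite !expnS.
apply: (@leq_trans (#|P|.-1 * size s' * #|P| ^ m)%N).
  by rewrite mulnA leq_mul2r hs' orbT.
by rewrite -!mulnA leq_mul2l IH orbT.
Qed.

(** * Orthogonal matrices with block indicator columns *)

(* A generalized reflection: with [B = E - U] one has [B^T B = 2 (1 - a)], so
   [1 - (1 - a)^-1 B B^T] is a symmetric involution exchanging [E] and [U]. *)
Lemma orthogonal_exchange (F : fieldType) (n m : nat) (E U : 'M[F]_(n, m)) (a : F) :
  a != 1 -> E^T *m E = 1%:M -> U^T *m U = 1%:M -> E^T *m U = a%:M ->
  exists V : 'M[F]_n, V *m V^T = 1%:M /\ V *m E = U.
Proof.
move=> a1 EE UU EU.
have a1' : 1 - a != 0 by rewrite subr_eq0 eq_sym.
have UE : U^T *m E = a%:M by rewrite -[LHS]trmxK trmx_mul trmxK EU tr_scalar_mx.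
pose B := E - U; pose W := B *m B^T.
have BE : B^T *m E = (1 - a)%:M.
  by rewrite /B linearB /= mulmxBl EE UE raddfB.
have BB : B^T *m B = (2 * (1 - a))%:M.
  rewrite {2}/B mulmxBr BE /B linearB /= mulmxBl EU UU -!raddfB /=; congr _%:M; ring.
have WW : W *m W = (2 * (1 - a)) *: W.
  by rewrite /W mulmxA -(mulmxA B) BB mul_mx_scalar -scalemxAl.
exists (1%:M - (1 - a)^-1 *: W); split.
  have -> : (1%:M - (1 - a)^-1 *: W)^T = 1%:M - (1 - a)^-1 *: W.
    by rewrite linearB /= linearZ /= tr_scalar_mx /W trmx_mul trmxK.
  rewrite mulmxBr mulmx1 mulmxBl mul1mx -scalemxAl -scalemxAr WW !scalerA.
  rewrite opprB -addrA -[RHS]addr0; congr (_ + _).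
  by rewrite -scaleNr -!scalerDl; apply/eqP; rewrite scaler_eq0; apply/orP; left; apply/eqP; field.
by rewrite mulmxBl mul1mx -scalemxAl /W -mulmxA BE mul_mx_scalar scalerA mulVf // scale1r /B subKr.
Qed.

Lemma block_index_subproof (n k : nat) (b : 'I_(n %/ k)) (j : 'I_k) : (b * k + j < n)%N.
Proof.
apply: (@leq_trans (b.+1 * k)); first by rewrite mulSn addnC ltn_add2r.
by apply: leq_trans (leq_divM n k); rewrite leq_mul2r ltn_ord orbT.
Qed.

Definition block_index (n k : nat) (b : 'I_(n %/ k)) (j : 'I_k) : 'I_n :=
  Ordinal (block_index_subproof b j).

Lemma block_sum (V : nmodType) (n k : nat) (b : 'I_(n %/ k)) (F : 'I_n -> V) :
  \sum_(i < n | (i %/ k == b)%N) F i = \sum_(j < k) F (block_index b j).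
Proof.
(* For [k = 0] there are no blocks, since [n %/ 0 = 0]. *)
case: k b => [|k] b; first by case: b => b b_lt; exfalso; move: b_lt; rewrite divn0.
rewrite (reindex_onto (block_index b) (fun i => inord (i %% k.+1))) /=; last first.
  move=> i /eqP ib; apply/val_inj => /=.
  by rewrite inordK ?ltn_mod // -ib -divn_eq.
apply: eq_bigl => j.
rewrite divnMDl // (divn_small (ltn_ord j)) addn0 eqxx /=.
by apply/eqP/val_inj; rewrite /= modnMDl modn_small // inord_val.
Qed.

(** The basis vectors at the block heads ([E]) and the normalized block indicators ([U]) are
    orthonormal families with [E^T U = a], where [a = 1 / sqrt k] differs from 1 because [k > 1].
    Exchanging them puts the indicator of block [b] in column [hd b]. *)
Lemma orthogonal_block_means (R : realType) (n k : nat) : (1 < k)%N ->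
  exists2 V : 'M[R]_n, V *m V^T = 1%:M &
    forall b : 'I_(n %/ k), exists j : 'I_n,
      forall i : 'I_n, V i j = (i %/ k == b)%N%:R / Num.sqrt k%:R.
Proof.
move=> k1; have k0 : (0 < k)%N by apply: ltnW.
set a : R := (Num.sqrt k%:R)^-1.
have sk1 : 1 < Num.sqrt k%:R :> R by rewrite -[ltLHS]sqrtr1 ltr_sqrt ?ltr0n ?ltr1n.
have a1 : a != 1 by rewrite lt_eqF // invf_lt1 // (lt_trans _ sk1).
pose hd (b : 'I_(n %/ k)) : 'I_n := block_index b (Ordinal k0).
have hdE b : (hd b %/ k = b)%N by rewrite /= addn0 mulnK.
pose E : 'M[R]_(n, n %/ k) := \matrix_(i, b) (i == hd b)%:R.
pose U : 'M[R]_(n, n %/ k) := \matrix_(i, b) ((i %/ k == b)%N%:R * a).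
have Emul p (M : 'M[R]_(n, p)) b c : (E^T *m M) b c = M (hd b) c.
  rewrite mxE (bigD1 (hd b)) //= big1 ?addr0; last by move=> i /negPf ne; rewrite !mxE ne mul0r.
  by rewrite !mxE eqxx mul1r.
have EE : E^T *m E = 1%:M.
  apply/matrixP => b c; rewrite Emul !mxE; congr (nat_of_bool _)%:R.
  by apply/eqP/eqP => [/(congr1 (fun i : 'I_n => i %/ k)%N)|->//]; rewrite !hdE => /val_inj.
have EU : E^T *m U = a%:M.
  by apply/matrixP => b c; rewrite Emul !mxE hdE mulr_natl.
have UU : U^T *m U = 1%:M.
  apply/matrixP => b c; rewrite !mxE.
  under eq_bigr do rewrite !mxE mulrACA -natrM mulnb.
  rewrite -mulr_suml -natr_sum.
  have [<-|bc] := eqVneq b c.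
    under eq_bigr do rewrite andbb.
    rewrite -big_mkcond /= block_sum sum_nat_const card_ord muln1.
    by rewrite /a -invfM -expr2 sqr_sqrtr ?ler0n // mulfV // pnatr_eq0 -lt0n.
  rewrite big1 ?mul0r // => i _; case: eqP => //= ->.
  by rewrite (negPf (_ : val b != val c)) // (inj_eq val_inj).
have [V [VV VE]] := orthogonal_exchange a1 EE UU EU.
exists V => // b; exists (hd b) => i.
have := congr1 (fun M : 'M[R]_(n, n %/ k) => M i b) VE; rewrite !mxE => <-.
rewrite (bigD1 (hd b)) //= big1 ?addr0; last by move=> l /negPf ne; rewrite !mxE ne mulr0.
by rewrite !mxE eqxx mulr1.
Qed.

(** * Orthonormal families with large signed sums *)

Lemma le_mx_norm_coord (R : realType) (n : nat) (v : 'rV[R]_n) (j : 'I_n) :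
  `|v 0 j| <= mx_norm v.
Proof.
rewrite mx_normrE; exact: (le_bigmax _ (fun ij : 'I_1 * 'I_n => `|v ij.1 ij.2|) (0, j)).
Qed.

Lemma orthonormal_family_signed_rows (R : realType) (n : nat) (V : 'M[R]_n) (g : 'I_n -> R) :
  V *m V^T = 1%:M -> (forall i, g i * g i = 1) ->
  orthonormal_family (fun i => g i *: row i V).
Proof.
move=> VV gg i j; rewrite /dotprod.
have := congr1 (fun M : 'M[R]_n => M i j) VV; rewrite !mxE => VVij.
transitivity (g i * g j * (i == j)%:R).
  by rewrite -VVij mulr_sumr; apply: eq_bigr => l _; rewrite !mxE mulrACA.
by case: eqVneq => [->|_]; rewrite ?gg ?mulr1 ?mulr0.
Qed.

(** The size hypothesis pushes the greedy bound below one miss, so every [e] in [s] matches the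
    chosen pattern on some block. *)
Lemma orthonormal_family_large_on (R : realType) (n k : nat) (s : seq 'rV[R]_n) :
  (1 < k)%N ->
  (forall e, e \in s -> sign_vector e) ->
  ((2 ^ k).-1 ^ (n %/ k) * size s < (2 ^ k) ^ (n %/ k))%N ->
  exists x : 'I_n -> 'rV[R]_n, orthonormal_family x /\
    forall e, e \in s -> Num.sqrt k%:R <= mx_norm (\sum_(i < n) e 0 i *: x i).
Proof.
case: k => // k k1 signs size_s.
have [V VV Vb] := orthogonal_block_means R n k1.
(* Sign pattern of [e] on block [b], with [true] for [+1]. The default value covers only [b] outside
   the range of blocks. *)
pose f (b : nat) (e : 'rV[R]_n) : {ffun 'I_k.+1 -> bool} :=
  if insub b is Some b' then [ffun j => 0 < e 0 (block_index b' j)] else [ffun=> true].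
have [p] := greedy_hitting [ffun=> true] f s (n %/ k.+1).
rewrite card_ffun card_bool card_ord => hp.
have {hp} hit e : e \in s -> exists b : 'I_(n %/ k.+1), f b e = p b.
  move=> es; suff /existsP[b /eqP fb] : [exists b : 'I_(n %/ k.+1), f b e == p b] by exists b.
  apply: contraLR size_s.
  rewrite negb_exists => /forallP nhit; rewrite -leqNgt.
  apply: leq_trans hp; rewrite leq_pmull // -has_count; apply/hasP; exists e => //.
  apply/allP => b; rewrite mem_iota add0n => /andP[_ bm].
  exact: (nhit (Ordinal bm)).
pose g (i : 'I_n) : R := (-1) ^+ ~~ p (i %/ k.+1)%N (inord (i %% k.+1)).
have gg i : g i * g i = 1 by rewrite -expr2 sqrr_sign.
exists (fun i => g i *: row i V); split; first exact: orthonormal_family_signed_rows.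
move=> e es; have [b fb] := hit e es; have [j Vj] := Vb b.
apply: le_trans (le_mx_norm_coord _ j); apply: le_trans (ler_norm _).
rewrite summxE.
(* Column [j] vanishes off block [b], and on it [e 0 i * g i = 1]: [k.+1] equal terms remain. *)
have -> : \sum_(i < n) (e 0 i *: (g i *: row i V)) 0 j
   = \sum_(i < n | (i %/ k.+1 == b)%N) (Num.sqrt k.+1%:R)^-1.
  rewrite [RHS]big_mkcond /=; apply: eq_bigr => i _; rewrite !mxE Vj.
  case: eqP => ib; last by rewrite mul0r !mulr0.
  rewrite mul1r mulrA -[RHS]mul1r; congr (_ * _).
  have ij : block_index b (inord (i %% k.+1)) = i.
    by apply/val_inj; rewrite /= inordK ?ltn_mod // -ib -divn_eq.
  have := congr1 (fun q : {ffun _ -> _} => q (inord (i %% k.+1))) fb.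
  rewrite /f valK ffunE ij /g ib => <-.
  by case: (signs e es i) => ->; rewrite ?ltr01 ?oppr_gt0 ?ltr10 /= ?expr0 ?expr1 ?mulrNN ?mulr1.
rewrite block_sum sumr_const card_ord -[leRHS]mulr_natl.
rewrite -{2}(@sqr_sqrtr R k.+1%:R) ?ler0n // expr2 mulfK // gt_eqF // sqrtr_gt0 ltr0n.
Qed.

Lemma orthonormal_family_std (R : realType) (n : nat) (e : 'rV[R]_n) :
  (0 < n)%N -> sign_vector e ->
  1 <= mx_norm (\sum_(i < n) e 0 i *: row i (1%:M : 'M[R]_n)).
Proof.
case: n e => // n e _ se.
apply: le_trans (le_mx_norm_coord _ 0).
rewrite summxE (bigD1 0) //= big1 ?addr0; last first.
  by move=> i i0; rewrite !mxE (negPf i0) mulr0.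
by rewrite !mxE eqxx mulr1; case: (se 0) => ->; rewrite ?normrN1 ?normr1.
Qed.

(** * Numerical estimates *)

Lemma expR1_ge2 (R : realType) : 2 <= expR 1 :> R.
Proof. by have := @expR_ge1Dx R 1; rewrite -natr1 addrC. Qed.

(** Here [1 / delta < 4 ^ j <= e ^ (2 j)], because [2 <= e]. *)
Lemma ln_expR1_div_le (R : realType) (delta : R) (j : nat) :
  0 < delta -> 1 < 4 ^+ j * delta -> ln (expR 1 / delta) <= (2 * j).+1%:R.
Proof.
move=> d0 h.
rewrite -[leRHS]expRK ler_ln ?posrE ?expR_gt0 ?divr_gt0 ?expR_gt0 //.
rewrite -[_.+1%:R]mulr1 expRM_natl exprS ler_pM2l ?expR_gt0 //.
rewrite -[leLHS]mul1r ler_pdivrMr // (le_trans (ltW h)) // ler_wpM2r ?(ltW d0) // exprM.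
apply: lerXn2r; rewrite ?nnegrE ?exprn_ge0 ?expR_ge0 //.
have -> : 4 = 2 ^+ 2 :> R by rewrite -natrX.
by apply: lerXn2r; rewrite ?nnegrE ?expR_ge0 ?expR1_ge2.
Qed.

(** With [K = 2 ^ k] and [m = n %/ k], one has [(1 - 1 / K) ^ m <= exp (- m / K)]. Since
    [delta <= K ^ -2] and [n <= K m], also [N <= 2 ^ (delta n) < exp (delta n) <= exp (m / K)]. *)
Lemma few_sign_vectors (R : realType) (n k N : nat) (delta : R) :
  (0 < n)%N -> (0 < k)%N -> (k <= n)%N -> 0 < delta -> 4 ^+ k * delta <= 1 ->
  N%:R <= 2 `^ (delta * n%:R) ->
  ((2 ^ k).-1 ^ (n %/ k) * N < (2 ^ k) ^ (n %/ k))%N.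
Proof.
move=> n0 k0 kn d0 dk hN; set m := (n %/ k)%N; set K := (2 ^ k)%N.
have K0 : 0 < K%:R :> R by rewrite ltr0n expn_gt0.
(* [n < k (m + 1) <= 2 k m <= K m], using [m >= 1] and [2 k <= 2 ^ k]. *)
have nKm : (n <= K * m)%N.
  have k2 : (2 * k <= K)%N.
    rewrite /K; case: (k) k0 => // l _.
    by rewrite expnS leq_mul2l /= ltn_expl.
  have m0 : (0 < m)%N by rewrite divn_gt0.
  have nE := divn_eq n k; have rk := ltn_pmod n k0.
  rewrite -/m in nE; nia.
have dm : delta * n%:R <= m%:R / K%:R.
  rewrite ler_pdivlMr //.
  have nKm' : n%:R <= K%:R * m%:R :> R by rewrite -natrM ler_nat.
  have dK : K%:R * K%:R * delta <= 1.
    by rewrite -natrM /K -expnMn natrX.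
  have m0 : 0 <= m%:R :> R by rewrite ler0n.
  apply: (@le_trans _ _ (delta * (K%:R * m%:R) * K%:R)).
    by rewrite ler_pM2r // ler_pM2l.
  rewrite (_ : _ * _ = K%:R * K%:R * delta * m%:R); last by ring.
  by rewrite -[leRHS]mul1r ler_wpM2r.
have ln2_lt1 : ln 2 < 1 :> R.
  rewrite -[ltRHS](@expRK R) ltr_ln ?posrE ?expR_gt0 ?ltr0n //.
  by have := @expR_gt1Dx R 1 (oner_neq0 _); rewrite -natr1 addrC.
have pow_lt : 2 `^ (delta * n%:R) < expR (m%:R / K%:R).
  rewrite /powR pnatr_eq0 /= ltr_expR (lt_le_trans _ dm) //.
  by rewrite gtr_pMr // mulr_gt0 // ltr0n.
have K1 : (K.-1)%:R <= K%:R * expR (- K%:R^-1) :> R.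
  have := @expR_ge1Dx R (- K%:R^-1).
  rewrite -(ler_pM2l K0) mulrDr mulr1 mulrN mulfV ?gt_eqF //.
  by rewrite -subn1 natrB // expn_gt0.
have natrXm (a : nat) : (a ^ m)%:R = a%:R ^+ m :> R by rewrite natrX.
rewrite -(ltr_nat R) natrM !natrXm.
have K1m : (K.-1)%:R ^+ m <= K%:R ^+ m * expR (- (m%:R / K%:R)) :> R.
  rewrite -mulrN expRM_natl -exprMn.
  by apply: lerXn2r; rewrite ?nnegrE ?ler0n // mulr_ge0 ?expR_ge0 // ler0n.
apply: (@le_lt_trans _ _ (K%:R ^+ m * expR (- (m%:R / K%:R)) * N%:R)).
  by rewrite ler_wpM2r.
rewrite -mulrA gtr_pMr ?exprn_gt0 // expRN mulrC ltr_pdivrMr ?expR_gt0 // mul1r.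
exact: le_lt_trans hN pow_lt.
Qed.

Theorem theorem1p2 (R : realType) :
  exists c : R, 0 < c < 1 /\
  forall (n : nat) (delta : R) (S : {fset 'rV[R]_n}),
    (1 <= n)%N ->
    n%:R^-1 < delta < 1 ->
    (forall e : 'rV[R]_n, e \in S -> sign_vector e) ->
    #|` S|%:R <= 2 `^ (delta * n%:R) ->
    exists x : 'I_n -> 'rV[R]_n,
      orthonormal_family x /\
      forall e : 'rV[R]_n, e \in S ->
        c * Num.sqrt (ln (expR 1 / delta)) <= mx_norm (\sum_(i < n) e 0 i *: x i).
Proof.
exists (3^-1); split; first by rewrite invr_gt0 ltr0n /= invf_lt1 ?ltr0n // ltr1n.
move=> n delta S n0 /andP[nd d1] signs cardS.
have d0 : 0 < delta by apply: lt_trans nd; rewrite invr_gt0 ltr0n.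
have dn : 1 < n%:R * delta by rewrite -ltr_pdivrMl ?ltr0n // mulr1.
(* The constant [1 / 3] comes from [ln (e / delta) <= 2 j + 1 <= 9 k]. It is used with [j = k + 1],
   where [2 k + 3 <= 9 k] for all [k >= 1]. *)
have third j k : (0 < k)%N -> (2 * j < 9 * k)%N -> 1 < 4 ^+ j * delta ->
    3^-1 * Num.sqrt (ln (expR 1 / delta)) <= Num.sqrt k%:R.
  move=> k0 jk dj; rewrite ler_pdivrMl ?ltr0n //.
  have -> : 3 * Num.sqrt k%:R = Num.sqrt (9 * k)%:R :> R.
    have -> : (9 * k)%:R = 3 ^+ 2 * k%:R :> R by rewrite -natrX -natrM.
    by rewrite sqrtrM ?exprn_ge0 // sqrtr_sqr ger0_norm.
  apply: ler_wsqrtr; apply: le_trans (ln_expR1_div_le d0 dj) _.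
  by rewrite ler_nat.
(* For [delta > 1 / 16] the norm 1 given by the standard basis suffices. *)
have [d16|d16] := ltP 1 (4 ^+ 2 * delta).
  exists (fun i => row i 1%:M); split => [i j|e eS].
    have := @orthonormal_family_signed_rows R n 1%:M (fun=> 1).
    rewrite trmx1 mulmx1 => /(_ erefl (fun=> mulr1 1) i j).
    by rewrite !scale1r.
  apply: le_trans (orthonormal_family_std n0 (signs e eS)).
  by rewrite -[leRHS]sqrtr1; apply: (third 2 1)%N d16.
have exj : exists j, 1 < 4 ^+ j * delta.
  exists n; apply: lt_trans dn _; rewrite ltr_pM2r // -natrX ltr_nat.
  exact: ltn_expl.
(* The maximal [k] is the predecessor of the least [j] with [4 ^ j * delta > 1]; here [j > 2], hence
   [k >= 2]. *)
case: (ex_minnP exj) => j dj minj.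
have j2 : (2 < j)%N.
  rewrite ltnNge; apply/negP => j2; move: dj; apply/negP; rewrite -leNgt.
  apply: le_trans d16; rewrite ler_pM2r //; apply: ler_weXn2l => //.
  by rewrite ler1n.
case: j j2 dj minj => // k k2 dj minj.
have dk : 4 ^+ k * delta <= 1.
  by rewrite leNgt; apply/negP => /minj; rewrite ltnn.
have k0 : (0 < k)%N by case: (k) k2.
(* At least one full block exists: [k > n] would give [n * delta <= 4 ^ k * delta <= 1]. *)
have kn : (k <= n)%N.
  rewrite leqNgt; apply/negP => nk; move: dn; apply/negP; rewrite -leNgt.
  apply: le_trans dk; rewrite ler_pM2r // -natrX ler_nat.
  by apply: leq_trans (ltnW nk) (ltnW (ltn_expl k _)).
have [x [ox hx]] := @orthonormal_family_large_on R n k S k2 signs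
  (few_sign_vectors n0 k0 kn d0 dk cardS).
exists x; split => // e eS; apply: le_trans (hx e eS).
by apply: third dj => //; lia.
Qed.
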